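(* Let $G$ be a finite group with $\Phi(G)=1$. If $\Phi(G/N)=1$ for all normal subgroups $N$ of $G$ containing the generalised Fitting subgroup $F^{*}(G)$, then $G$ belongs to $\mathfrak{B}$, that is, $\Phi(G/N)=1$ for every normal subgroup $N$ of $G$.
   Context: All groups are finite. $\Phi(G)$ denotes the Frattini subgroup of $G$; a group is called $\Phi$-free if its Frattini subgroup is trivial. $\mathfrak{B}$ denotes the class of finite groups $G$ such that $G/N$ is $\Phi$-free for all normal subgroups $N$ of $G$. The generalised Fitting subgroup of $G$ is $F^{*}(G)=E(G)F(G)$, where $F(G)$ is the Fitting subgroup of $G$ and $E(G)$ (the layer) is the product of all components of $G$, a component being a subnormal quasi-simple subgroup $Q$ (i.e. $Q$ is perfect and $Q/Z(Q)$ is simple). *)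

(* Defs.v *)
From mathcomp Require Import all_boot all_fingroup all_solvable.

Set Implicit Arguments.
Unset Strict Implicit.
Unset Printing Implicit Defensive.

Local Open Scope group_scope.

Definition Phi_free (gT : finGroupType) (A : {set gT}) : bool := 'Phi(A) == 1.

Definition class_B (gT : finGroupType) (G : {group gT}) : Prop :=
  forall N : {group gT}, N <| G -> Phi_free (G / N).

(* [simple] excludes the trivial group, so the trivial group is not
   quasi-simple. *)
Definition quasisimple (gT : finGroupType) (Q : {group gT}) : bool :=
  (Q^`(1) == Q) && simple (Q / 'Z(Q)).

Definition component (gT : finGroupType) (Q G : {group gT}) : bool :=
  (Q <|<| G) && quasisimple Q.

(* In Group_scope, [\prod] is the subgroup generated by the factors; it is
   trivial when G has no component. *)
Definition layer (gT : finGroupType) (G : {group gT}) : {group gT} :=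
  (\prod_(Q : {group gT} | component Q G) Q)%G.

Definition generalised_Fitting (gT : finGroupType) (G : {group gT}) :
  {set gT} := layer G * 'F(G).

(* Main.v *)
Require Import Defs.
From mathcomp Require Import all_boot all_fingroup all_solvable.

Local Open Scope group_scope.

(* Let R / N = 'Phi(G / N).  As G / N 'F*(G) is Phi-free, R <= N 'F*(G).  A
   component of G either lies in R, hence in N since R / N is nilpotent, or
   centralises R; it follows that R <= N 'F(G), so that R = N T with T = R :&: 'F(G)
   abelian.  To show T <= N, argue by induction on |N|: if N / D is a chief factor
   of G then G / D is Phi-free, so one may assume that N is minimal normal in G.
   If N T is abelian, a complement C of N T in G gives N C = G because N T / N
   consists of nongenerators, whence T <= N.  Otherwise T centralises N and N is
   perfect; T has a complement C in G, and N = N^`(1) lies in (C :&: N T)^`(1), as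
   N T is the central product of T and C :&: N T.  So N <= C and T C = G, whence
   C = G and T = 1. *)

(** * Nongenerators, complements and minimal normal subgroups *)

Section Frattini.

Local Set Implicit Arguments.
Local Unset Strict Implicit.

Context {gT : finGroupType}.
Implicit Types G H K A C D N R T : {group gT}.

Lemma Phi_nongen_mul G H : H \subset G -> 'Phi(G) * H = G -> H :=: G.
Proof.
move=> sHG defG; rewrite -[RHS](@Phi_nongen _ G H) ?genGid //.
by rewrite norm_joinEr // (subset_trans sHG) ?gFnorm.
Qed.

(** A maximal subgroup [M] not containing [A] would satisfy [A * M = G]. *)
Lemma sub_Phi G A :
    A <| G -> (forall C, C \subset G -> A * C = G -> C :=: G) ->
  A \subset 'Phi(G).
Proof.
move=> /andP[sAG nAG] ngA; apply/bigcapsP => M /predU1P[-> // | maxM].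
apply: contraT => nsAM; have [ltMG maxM'] := maxgroupP maxM.
have sMG := proper_sub ltMG; have nAM := subset_trans sMG nAG.
suffices defG : A * M = G by rewrite (ngA M sMG defG) properxx in ltMG.
apply/eqP; rewrite eqEproper mul_subG //= -norm_joinEr //.
apply: contra nsAM => ltAMG.
by rewrite -(maxM' _ ltAMG (joing_subr A M)) joing_subl.
Qed.

(** By the Frattini argument the normaliser in [G] of a Sylow subgroup of ['Phi(G)] supplements
    ['Phi(G)], so it is all of [G]. *)
Lemma Phi_nil G : nilpotent 'Phi(G).
Proof.
rewrite (nilpotentS _ (Fitting_nil 'Phi(G))) //= -{1}(Sylow_gen 'Phi(G)) gen_subG.
apply/bigcupsP=> P /SylowP[p _ sylP].
have sPG := subset_trans (pHall_sub sylP) (Phi_sub G).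
apply: Fitting_max (pgroup_nil (pHall_pgroup sylP)).
have defG := Phi_nongen_mul (subsetIl G _) (Frattini_arg (Phi_normal G) sylP).
apply: normalS (pHall_sub sylP) (Phi_sub G) _.
by rewrite /normal sPG -{1}defG subsetIr.
Qed.

(* A minimal supplement C of A is a complement: A :&: C is normal in G, and its
   elements are nongenerators of C by minimality, hence of G. *)
Lemma Phi_free_compl G A :
    Phi_free G -> A <| G -> abelian A ->
  exists C : {group gT}, [/\ C \subset G, A * C = G & A :&: C = 1].
Proof.
move=> /eqP PhiG /andP[sAG nAG] abA.
have [C] : {C : {group gT} | [min C | (C \subset G) && (A * C == G)]}.
  by apply: ex_mingroup; exists G; rewrite /= subxx mulSGid /=.
case/mingroupP=> /andP[sCG /eqP defG] minC; exists C; split=> //.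
(* [A] centralises this intersection and [C] normalises it. *)
have nsACG : A :&: C <| G.
  rewrite /normal subIset ?sAG // -{1}defG mul_subG //.
    by rewrite cents_norm // (subset_trans abA) ?centS ?subsetIl.
  by rewrite normsI ?normG // (subset_trans sCG).
apply/trivgP; rewrite -PhiG; apply: sub_Phi => //.
move=> M sMG defM; suffices sACM : A :&: C \subset M by rewrite -defM mulSGid.
have defC : (A :&: C) * (C :&: M) = C.
  by rewrite (setIC C M) group_modl ?subsetIr // defM; apply/setIidPr.
have defCM : C :&: M = C.
  apply: minC; last exact: subsetIl.
  by rewrite subIset ?sCG //= -{1}(mulGSid (subsetIl A C)) -mulgA defC defG eqxx.
by rewrite (subset_trans (subsetIr A C)) // -defCM subsetIr.
Qed.

(** A proper [H], being subnormal, lies in a proper normal [K]; then [G / K] would be solvable,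
    nontrivial and perfect. *)
Lemma nil_der1_supplement G H :
  nilpotent G -> H \subset G -> G^`(1) * H = G -> H :=: G.
Proof.
move=> nilG sHG defG.
have [// | [K [snHK nsKG ltKG]]] := subnormalEr (nilpotent_subnormal nilG sHG).
have [sKG nKG] := andP nsKG.
have ntGK : G / K != 1.
  by apply: contraTneq ltKG => GK1; rewrite properE -(quotient_sub1 nKG) GK1 subxx andbF.
have := sol_der1_proper (nilpotent_sol (quotient_nil K nilG)) (subxx _) ntGK.
rewrite properE -quotient_der // => /andP[_ /negP[]] /=.
have <- : (G^`(1) / K) * (H / K) = G / K.
  by rewrite -quotientMr ?defG // (subset_trans sHG).
by rewrite (quotientS1 (subnormal_sub snHK)) mulg1.
Qed.

Lemma Phi_free_Fitting_abelian G : Phi_free G -> abelian 'F(G).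
Proof.
move=> /eqP PhiG; apply/derG1P/trivgP; rewrite -PhiG.
have nsFG : 'F(G)^`(1) <| G by rewrite !gFnormal_trans.
apply: sub_Phi => //.
move=> M sMG /= defG.
suffices defF : 'F(G) :&: M = 'F(G).
  rewrite -[RHS]defG mulSGid // (subset_trans (der_sub 1 _)) //=.
  by rewrite -defF subsetIr.
apply: nil_der1_supplement (Fitting_nil G) (subsetIl _ _) _ => /=.
by rewrite setIC group_modl ?der_sub //= defG (setIidPr (Fitting_sub G)).
Qed.

Lemma minnormal_normal_sub G N T :
  minnormal N G -> T <| G -> N \subset T \/ T :&: N = 1.
Proof.
case/mingroupP=> /andP[ntN nNG] minN /andP[sTG nTG].
have [-> | ntTN] := eqVneq (T :&: N) 1; [by right | left].
have <- : (T :&: N)%G :=: N by apply: minN; rewrite /= ?subsetIr ?ntTN ?normsI.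
exact: subsetIl.
Qed.

(** The last hypothesis says that the image of [T] in [G / N] lies in ['Phi(G / N)]. *)
Lemma minnormal_abelian_supplement G N T :
    Phi_free G -> N <| G -> minnormal N G -> T <| G -> abelian T ->
    (forall C, N \subset C -> C \subset G -> T * C = G -> C :=: G) ->
  T \subset N.
Proof.
move=> PhiG nsNG minN nsTG abT ngT.
have [[sNG nNG] [sTG nTG]] := (andP nsNG, andP nsTG).
have [ntN _] := andP (mingroupp minN).
have [abTN | nabTN] := boolP (abelian (T <*> N)).
  have [C [sCG defG tiC]] := Phi_free_compl PhiG (normalY nsTG nsNG) abTN.
  have nNC := subset_trans sCG nNG.
  have defNC : N <*> C = G.
    apply: ngT; rewrite ?joing_subl ?join_subG ?sNG //= norm_joinEr //.
    by rewrite mulgA -(norm_joinEl (subset_trans sTG nNG)).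
  apply: subset_trans (joing_subl T N) _.
  have <- : N * (C :&: (T <*> N)) = T <*> N.
    rewrite group_modl ?joing_subr // -norm_joinEr // defNC.
    by apply/setIidPr; rewrite join_subG sTG.
  by rewrite setIC tiC mulg1.
have [sNT | tiTN] := minnormal_normal_sub minN nsTG.
  by rewrite (joing_idPl sNT) abT in nabTN.
have cTN : N \subset 'C(T).
  apply/commG1P/trivgP; rewrite -tiTN setIC.
  by apply: commg_subI; rewrite subsetI subxx /= (subset_trans _ nTG, subset_trans _ nNG).
have nabN : ~~ abelian N.
  by apply: contra nabTN => abN; rewrite abelianY abT abN cTN.
have [C [sCG defG tiTC]] := Phi_free_compl PhiG nsTG abT.
suffices sNC : N \subset C.
  by rewrite -(setIidPl sTG) -(ngT C) // tiTC sub1G.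
have perfN : N^`(1) = N.
  have [_ minN'] := mingroupP minN; apply: minN'; last exact: der_sub.
  by rewrite (sameP eqP derG1P) nabN gFnorm_trans.
have defTN : T * N = T * (C :&: (T <*> N)).
  rewrite group_modl ?joing_subl // defG -cent_joinEr //.
  by apply/esym/setIidPr; rewrite join_subG sTG.
have cTN1 : C :&: (T <*> N) \subset 'C(T).
  by rewrite subIset // join_subG [T \subset _]abT cTN orbT.
(* The derived subgroup of this central product is that of its second factor, as [T] is abelian;
   hence it lies in [C]. *)
have defTNc : T \* (C :&: (T <*> N)) = T <*> N.
  by rewrite cprodE // -defTN cent_joinEr.
have /cprodP[_ defD _] := der_cprod 1 defTNc.
rewrite -perfN (subset_trans (dergS 1 (joing_subr T N))) //= -defD.
by rewrite (derG1P abT) mul1g (subset_trans (der_sub _ _)) ?subsetIl.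
Qed.

End Frattini.

(** * Nongenerators of a quotient, expressed in the group itself *)

Section QuotientFrattini.

Local Set Implicit Arguments.
Local Unset Strict Implicit.

Context {gT : finGroupType}.
Implicit Types G C D N R T : {group gT}.

Lemma quotient_supplement D G T C :
    D <| G -> T <| G -> D \subset C -> C \subset G ->
  (T / D) * (C / D) = G / D -> T * C = G.
Proof.
move=> nsDG /andP[sTG nTG] sDC sCG defGD; have [sDG nDG] := andP nsDG.
have sTCG : T <*> C \subset G by rewrite join_subG sTG.
rewrite -norm_joinEr ?(subset_trans sCG) //.
apply: (quotient_inj _ nsDG); last first.
  rewrite /= norm_joinEr ?(subset_trans sCG) // quotientMl //.
  exact: subset_trans sTG nDG.
by apply: (normalS _ _ nsDG); rewrite // (subset_trans sDC) ?joing_subr.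
Qed.

Lemma sub_Phi_quotientP N G R :
    N <| G -> R <| G ->
  reflect (forall C, N \subset C -> C \subset G -> R * C = G -> C :=: G)
          (R / N \subset 'Phi(G / N)).
Proof.
move=> nsNG nsRG; have [[sNG nNG] [sRG nRG]] := (andP nsNG, andP nsRG).
apply: (iffP idP) => [sRPhi C sNC sCG defG | ngR].
  apply: (quotient_inj (normalS sNC sCG nsNG) nsNG).
  apply: (@Phi_nongen_mul _ (G / N) (C / N)); first exact: quotientS.
  apply/eqP; rewrite eqEsubset mul_subG ?Phi_sub ?quotientS //=.
  by rewrite -[in X in X \subset _]defG quotientMl ?mulSg // (subset_trans sRG).
apply: sub_Phi; first exact: quotient_normal.
move=> Cb sCG; case/inv_quotientS: (sCG) => // C -> sNC sCG' defGN.
by rewrite (ngR C) // (quotient_supplement _ _ _ _ defGN).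
Qed.

End QuotientFrattini.

(** * Components and the layer *)

Section Layer.

Local Set Implicit Arguments.
Local Unset Strict Implicit.

Context {gT : finGroupType}.
Implicit Types G H N Q R : {group gT}.

(** By simplicity of [Q / 'Z(Q)], the product of [R] and ['Z(Q)] is ['Z(Q)] or [Q]; if it is [Q],
    then [Q / R] is abelian and [Q] is perfect. *)
Lemma quasisimple_normal_sub Q R :
  quasisimple Q -> R <| Q -> Q \subset R \/ R \subset 'C(Q).
Proof.
case/andP=> /eqP perfQ; rewrite quotient_simple ?center_normal // => maxZ nsRQ.
have [sRQ nRQ] := andP nsRQ.
have [_ maxZ'] := maxgroupP maxZ.
have nsRZ : R <*> 'Z(Q) <| Q by rewrite normalY ?center_normal.
have [ltRZ | ] := boolP (R <*> 'Z(Q) \proper Q).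
  right; have := maxZ' (R <*> 'Z(Q))%G; rewrite ltRZ normal_norm //=.
  move=> /(_ isT (joing_subr _ _)) defZ.
  by rewrite (subset_trans (joing_subl R 'Z(Q))) // defZ subsetIr.
rewrite properE normal_sub //= negbK => sQRZ; left.
rewrite -perfQ der1_min // (abelianS (quotientS R sQRZ)) //.
rewrite joingC quotientYidr ?(subset_trans (center_sub Q)) //.
by rewrite quotient_abelian ?center_abelian.
Qed.

(** Induction on the order of [G], through a proper normal [K] containing [Q]. If [R :&: K], which
    contains [[~: R, Q]], centralises [Q], the three subgroups lemma applies to the perfect group
    [Q]. *)
Lemma component_sub_or_cent G Q R :
  component Q G -> R <| G -> Q \subset R \/ R \subset 'C(Q).
Proof.
case/andP=> snQG qsQ; have [m] := ubnP #|G|.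
elim: m G R snQG => // m IHm G R snQG leGm nsRG.
have [defQ | [K [snQK nsKG ltKG]]] := subnormalEr snQG.
  by apply: quasisimple_normal_sub; rewrite ?defQ.
have [[sKG nKG] [sRG nRG]] := (andP nsKG, andP nsRG).
have nsRKK : R :&: K <| K by rewrite setIC (normalGI sKG).
have ltKm : #|K| < m by apply: leq_trans (proper_card ltKG) _.
have [sQRK | cRKQ] := IHm K (R :&: K)%G snQK ltKm nsRKK.
  by left; rewrite (subset_trans sQRK) ?subsetIl.
right; have sQK := subnormal_sub snQK.
have sRQ_RK : [~: R, Q] \subset R :&: K.
  rewrite (subset_trans (commgS R sQK)) // commg_subI // subsetI subxx.
    by rewrite (subset_trans sRG).
  by rewrite (subset_trans sKG).
have RQQ : [~: R, Q, Q] = 1.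
  by apply/commG1P; rewrite (subset_trans sRQ_RK).
have QRQ : [~: Q, R, Q] = 1 by rewrite (commGC Q R).
have /andP[/eqP perfQ _] := qsQ.
rewrite centsC; apply/commG1P.
by rewrite -{1}perfQ; apply: three_subgroup.
Qed.

Lemma componentJ G Q x :
  x \in G -> component Q G -> component (Q :^ x)%G G.
Proof.
move=> Gx /andP[snQG /andP[/eqP perfQ simpQ]].
apply/andP; split.
  rewrite -(conjGid Gx) /= -(setTI Q) -(setTI G) -!morphim_conj.
  exact: morphim_subnormal.
rewrite /quasisimple /= derJ perfQ eqxx /=.
rewrite quotient_simple ?center_normal // in simpQ.
rewrite quotient_simple ?center_normal //= /center centJ -conjIg.
have subT := fun H => subsetT H.
have := injm_maxnormal (injm_conj [set: gT] x) (subT 'Z(Q)%G) (subT Q) (subT Q).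
by rewrite !morphim_conj !setTI => ->.
Qed.

Lemma component_sub_layer G Q : component Q G -> Q \subset layer G.
Proof. by move=> compQ; rewrite bigprodGE sub_gen // (bigcup_max Q). Qed.

Lemma layer_subP G H :
  reflect (forall Q, component Q G -> Q \subset H) (layer G \subset H).
Proof. by rewrite bigprodGE gen_subG; apply: bigcupsP. Qed.

Lemma layer_normal G : layer G <| G.
Proof.
apply/andP; split; first by apply/layer_subP=> Q /andP[/subnormal_sub].
apply/subsetP=> x Gx; rewrite -groupV inE sub_conjgV.
apply/(layer_subP G (layer G :^ x))=> Q compQ /=.
by rewrite -sub_conjgV (@component_sub_layer _ (Q :^ x^-1)) ?componentJ ?groupV.
Qed.

Lemma component_perfect G Q : component Q G -> Q^`(1) = Q.
Proof. by case/and3P=> _ /eqP. Qed.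

Lemma component_not_solvable G Q : component Q G -> ~~ solvable Q.
Proof.
case/and3P=> _ /eqP perfQ /simpleP[ntQZ _]; apply/negP=> solQ.
have ntQ : Q :!=: 1 by apply: contraNneq ntQZ => Q1; rewrite /= -subG1 quotient_sub1 ?gFnorm // Q1 sub1G.
by have := sol_der1_proper solQ (subxx _) ntQ; rewrite perfQ properxx.
Qed.

Lemma layer_cent_Fitting G : layer G \subset 'C('F(G)).
Proof.
apply/layer_subP=> Q compQ; rewrite centsC.
have [sQF | //] := component_sub_or_cent compQ (Fitting_normal G).
case/negP: (component_not_solvable compQ).
exact: solvableS sQF (nilpotent_sol (Fitting_nil G)).
Qed.

(* Each component lies in N or centralises R, so layer G lies in N * 'C_(layer G)(R);
   what is left of R outside N * 'F(G) is central in that centraliser. *)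
Lemma solvable_factor_sub_Fitting G N R :
    N <| G -> R <| G -> N \subset R -> solvable (R / N) ->
    R \subset N * (layer G * 'F(G)) ->
  R \subset N * 'F(G).
Proof.
move=> nsNG nsRG sNR solRN sRS.
have [[sNG nNG] [sRG nRG]] := (andP nsNG, andP nsRG).
pose E := ('C_(layer G)(R))%G; have [sLG nLG] := andP (layer_normal G).
have sEG : E \subset G by rewrite subIset ?sLG.
have nsEG : E <| G by rewrite /normal sEG normsI ?norms_cent.
have sLNE : layer G \subset N * E.
  rewrite -norm_joinEr ?(subset_trans sEG) //.
  apply/layer_subP=> Q compQ; have perfQ := component_perfect compQ.
  have [sQR | cRQ] := component_sub_or_cent compQ nsRG; last first.
    rewrite (subset_trans _ (joing_subr N E)) // subsetI component_sub_layer //.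
    by rewrite centsC.
  rewrite (subset_trans _ (joing_subl _ _)) //.
  have nNQ : Q \subset 'N(N) by rewrite (subset_trans sQR) // (subset_trans sRG).
  (* The image of [Q] in [R / N] is perfect and solvable, hence trivial. *)
  apply: contraT; rewrite -quotient_sub1 // subG1 => ntQN.
  have := sol_der1_proper solRN (quotientS N sQR) ntQN.
  by rewrite -quotient_der // perfQ properxx.
have sZF : 'Z(E) \subset 'F(G).
  by rewrite Fitting_max ?gFnormal_trans // abelian_nil ?center_abelian.
(* Write [r] as [n * n' * (e * f)]. Both [e * f], an element of [R], and [f] centralise [E], so [e]
   lies in ['Z(E)]. *)
apply/subsetP=> r Rr; have /mulsgP[n _ Nn /mulsgP[l f Ll Ff ->] defr] := subsetP sRS r Rr.
have /mulsgP[n' e Nn' Ee defl] := subsetP sLNE l Ll.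
rewrite {}defr {}defl !mulgA in Rr *; rewrite -mulgA.
have Ref : e * f \in R.
  by rewrite -mulgA groupMl // in Rr; rewrite (subsetP sNR) ?groupM.
have cEF : 'F(G) \subset 'C(E).
  by rewrite centsC (subset_trans _ (layer_cent_Fitting G)) ?subsetIl.
have cER : R \subset 'C(E) by rewrite centsC subsetIr.
have cEe : e \in 'C(E).
  by rewrite -(mulgK f e) groupM ?groupV ?(subsetP cER _ Ref) ?(subsetP cEF _ Ff).
apply: mem_mulg; rewrite groupM // (subsetP sZF) //.
by rewrite inE Ee.
Qed.

End Layer.

Theorem theoremA (gT : finGroupType) (G : {group gT})
    (PhiG : Phi_free G)
    (PhiGN : forall N : {group gT},
      N <| G -> generalised_Fitting G \subset N -> Phi_free (G / N)) :
  class_B G.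
Proof.
move=> N; have [m] := ubnP #|N|; elim: m N => // m IHm N leNm nsNG.
have [N1 | ntN] := eqVneq (N : {set gT}) 1.
  have -> : N = 1%G by apply: group_inj.
  by rewrite /Phi_free -(isog_eq1 (isog_Phi (quotient1_isog G))).
have [sNG nNG] := andP nsNG.
have [R defR sNR nsRG] := inv_quotientN nsNG (Phi_normal (G / N)).
have [sRG nRG] := andP nsRG.
have ngR : forall C : {group gT},
    N \subset C -> C \subset G -> R * C = G -> C :=: G.
  by apply/sub_Phi_quotientP; rewrite // -defR.
pose S := (layer G <*> 'F(G))%G.
have defS : S = generalised_Fitting G :> {set gT}.
  by rewrite /= cent_joinEl ?layer_cent_Fitting.
have nsSG : S <| G by rewrite normalY ?layer_normal ?Fitting_normal.
have sRNS : R \subset N * (layer G * 'F(G)).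
  rewrite -[layer G * _]defS -norm_joinEr; last first.
    exact: subset_trans (normal_sub nsSG) nNG.
  have nsNSG : N <*> S <| G by rewrite normalY.
  have nNSR := subset_trans sRG (normal_norm nsNSG).
  rewrite -quotient_sub1 // -(eqP (PhiGN _ nsNSG _)); last first.
    by rewrite -defS joing_subr.
  (* Subgroups containing [N <*> S] contain [N], so the image of [R] in [G / (N <*> S)] again
     consists of nongenerators. *)
  apply/sub_Phi_quotientP=> // C sNSC; apply: ngR.
  exact: subset_trans (joing_subl N S) sNSC.
have solRN : solvable (R / N) by rewrite -defR nilpotent_sol ?Phi_nil.
have sRNF := solvable_factor_sub_Fitting nsNG nsRG sNR solRN sRNS.
pose T := (R :&: 'F(G))%G.
have nsTG : T <| G by rewrite normalI ?Fitting_normal.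
have [sTG nTG] := andP nsTG.
have abT : abelian T.
  exact: abelianS (subsetIr _ _) (Phi_free_Fitting_abelian PhiG).
suffices sTN : T \subset N.
  rewrite /Phi_free defR -subG1 quotient_sub1 ?(subset_trans sRG nNG) //.
  have <- : N * T = R by rewrite /= setIC group_modl // (setIidPr sRNF).
  exact: mul_subG.
(* [N / D] is a chief factor, and induction applies to [D]. *)
have [D maxD _] : {D : {group gT} | maxnormal D N G & 1%G \subset D}.
  by apply: maxgroup_exists; rewrite proper1G ntN norms1.
have [/andP[ltDN nDG] _] := maxgroupP maxD.
have sDN := proper_sub ltDN.
have nsDG : D <| G by rewrite /normal (subset_trans sDN).
rewrite -(quotientSGK (subset_trans sTG nDG) sDN).
apply: (@minnormal_abelian_supplement _ (G / D) (N / D) (T / D)).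
- by apply: IHm => //; apply: leq_trans (proper_card ltDN) _.
- exact: quotient_normal.
- by apply: maxnormal_minnormal; rewrite ?(subset_trans sNG).
- exact: quotient_normal.
- exact: quotient_abelian.
(* A supplement of [T / D] containing [N / D] lifts to a supplement [C] of [T], hence of [R], with
   [N] inside [C]. *)
move=> Cb sNCb sCbG; case/inv_quotientS: (sCbG) => // C defCb sDC sCG.
rewrite {Cb}defCb in sNCb sCbG * => defGD.
have sNC : N \subset C by rewrite -(quotientSGK (subset_trans sNG nDG) sDC).
have defG := quotient_supplement nsDG nsTG sDC sCG defGD.
rewrite /= (ngR C) //; apply/eqP; rewrite eqEsubset mul_subG //=.
by rewrite -[in X in X \subset _]defG mulSg ?subsetIl.
Qed.
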